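(* The theory $\mathrm{RCA}_0^\omega + (\mathcal{U})$ proves $(\mu)$, i.e. $\mathrm{RCA}_0^\omega + (\mathcal{U}) \vdash (\mu)$, where $(\mathcal{U})$ is the statement that a non-principal ultrafilter on $\mathbb{N}$ exists and $(\mu)$ is the statement that Feferman's $\mu$ functional exists. In particular, $\mathrm{RCA}_0^\omega + (\mathcal{U})$ proves all axioms of $\mathrm{ACA}_0^\omega$.
   Context: **Types.** The finite types are generated by: $0$ is a type; if $\rho,\tau$ are types, so is $\tau(\rho)$ (functions from $\rho$ to $\tau$). $0$ is the type of natural numbers, $1 := 0(0)$, $2 := 0(0(0))$. Superscripts on variables indicate types. **The system $\mathrm{RCA}_0^\omega$.** Many-sorted classical logic with variables and quantifiers for every finite type. The only primitive equality is $=_0$; equality at higher types is defined extensionally ($x =_{\tau(\rho)} y :\equiv \forall z^\rho\, (xz =_\tau yz)$). Constants: $0^0$, successor $S^1$, combinators $\Pi_{\rho,\tau}$, $\Sigma_{\rho,\sigma,\tau}$ of all types (with $\Pi xy = x$, $\Sigma xyz = xz(yz)$, providing $\lambda$-abstraction), and the type-$0$ recursor $R_0$ with $R_0 0 y z =_0 y$, $R_0(x+1)yz =_0 z(R_0xyz)x$. Axioms: equality axioms, the usual successor axioms, the defining equations of the constants, induction for quantifier-free formulas, the extensionality axioms $\forall z^{\tau(\rho)},x^\rho,y^\rho\,(x=_\rho y \to zx =_\tau zy)$ for all types, and the schema $\mathrm{QF}\text{-}\mathrm{AC}^{1,0}$: $\forall f^1\exists x^0\, A_{qf}(f,x) \to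 \exists F^2\forall f^1\, A_{qf}(f,F(f))$ for $A_{qf}$ quantifier-free (parameters of arbitrary type allowed). **The system $\mathrm{ACA}_0^\omega$** is $\mathrm{RCA}_0^\omega$ plus $\Pi^0_1$-comprehension: $\forall f\,\exists g^1\,\forall n^0\,(g(n)=0 \leftrightarrow \forall x^0\, f(n,x)=0)$. **$(\mu)$:** $\exists \mu^2\,\forall f^1\,\big(\exists x^0\, f(x)=0 \to f(\mu(f))=0\big)$. **$(\mathcal U)$:** type-$1$ objects $X$ are viewed as characteristic functions of sets, with $n\in X :\equiv X(n)=0$; $X\cap Y$ is the pointwise maximum of $X$ and $Y$; $\overline{X}$ is the complement; $X\in\mathcal U :\equiv \mathcal U(X)=0$. $(\mathcal U)$ is the statement that there is $\mathcal U^2$ such that (1) $\forall X\,(X\in\mathcal U \lor \overline X\in\mathcal U)$; (2) $\forall X,Y\,(X\cap Y\in\mathcal U\to Y\in\mathcal U)$; (3) $\forall X,Y\,(X,Y\in\mathcal U\to X\cap Y\in\mathcal U)$; (4) $\forall X\,(X\in\mathcal U\to\forall n\exists k>n\,(k\in X))$; (5) $\forall X\,(\mathcal U(X)=_0\mathcal U(\lambda n.\min(X(n),1)))$. *)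

(* Defs.v *)
(* Stdlib only: a deep embedding of the finite-type systems, with an
   intrinsically typed syntax (de Bruijn variables) and natural deduction. *)
From Stdlib Require Import List.
Import ListNotations.

Set Implicit Arguments.
Unset Strict Implicit.
Unset Printing Implicit Defensive.

Declare Scope ty_scope.
Declare Scope tm_scope.
Declare Scope fm_scope.
Delimit Scope ty_scope with ty.
Delimit Scope tm_scope with tm.
Delimit Scope fm_scope with fm.

(** * Types and terms *)

(* [N] is the type 0 and [Arr rho tau], written [rho ==> tau], is tau(rho). *)
Inductive ty : Set := N : ty | Arr : ty -> ty -> ty.
Bind Scope ty_scope with ty.
Infix "==>" := Arr (at level 55, right associativity) : ty_scope.
Open Scope ty_scope.

Definition ty1 : ty := N ==> N.
Definition ty2 : ty := ty1 ==> N.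

Definition ctx := list ty.

Inductive var : ctx -> ty -> Type :=
| V0 : forall (G : ctx) (tau : ty), var (tau :: G) tau
| VS : forall (G : ctx) (tau sigma : ty), var G tau -> var (sigma :: G) tau.
Arguments V0 {G tau}.
Arguments VS {G tau sigma} _.

Inductive const : ty -> Type :=
| Zero : const N
| Succ : const (N ==> N)
| Pi (rho tau : ty) : const (rho ==> tau ==> rho)
| Sigma (rho sigma tau : ty) :
    const ((rho ==> sigma ==> tau) ==> (rho ==> sigma) ==> rho ==> tau)
| R0 : const (N ==> N ==> (N ==> N ==> N) ==> N).

Inductive term (G : ctx) : ty -> Type :=
| Var (tau : ty) : var G tau -> term G tau
| Con (tau : ty) : const tau -> term G tau
| App (rho tau : ty) : term G (rho ==> tau) -> term G rho -> term G tau.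
Arguments Var {G tau} _.
Arguments Con {G tau} _.
Arguments App {G rho tau} _ _.
Bind Scope tm_scope with term.
Infix "@" := App (at level 38, left associativity) : tm_scope.
Open Scope tm_scope.

Definition ren (G D : ctx) := forall tau : ty, var G tau -> var D tau.
Definition sub (G D : ctx) := forall tau : ty, var G tau -> term D tau.

Fixpoint rent (G D : ctx) (r : ren G D) (tau : ty) (t : term G tau)
  : term D tau :=
  match t with
  | Var v => Var (r _ v)
  | Con c => Con c
  | App s u => rent r s @ rent r u
  end.

Fixpoint subt (G D : ctx) (s : sub G D) (tau : ty) (t : term G tau)
  : term D tau :=
  match t with
  | Var v => s _ v
  | Con c => Con c
  | App u w => subt s u @ subt s w
  end.

Definition shift (G : ctx) (rho : ty) : ren G (rho :: G) := fun _ v => VS v.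
Arguments shift {G rho} tau _.

Definition from_nil (G : ctx) : ren [] G :=
  fun tau v => match v in var G' _ return
                 match G' with [] => var G tau | _ :: _ => unit end
               with V0 => tt | VS _ => tt end.

Definition scons (G D : ctx) (rho : ty) (t : term D rho) (s : sub G D)
  : sub (rho :: G) D :=
  fun tau v =>
    match v in var G' tau' return
      match G' with
      | [] => unit
      | rho' :: G'' => term D rho' -> sub G'' D -> term D tau'
      end
    with
    | V0 => fun t _ => t
    | VS w => fun _ s => s _ w
    end t s.

Definition upr (G D : ctx) (rho : ty) (r : ren G D)
  : ren (rho :: G) (rho :: D) :=
  fun tau v =>
    match v in var G' tau' return
      match G' with
      | [] => unit
      | rho' :: G'' => ren G'' D -> var (rho' :: D) tau'
      end
    with
    | V0 => fun _ => V0
    | VS w => fun r => VS (r _ w)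
    end r.

Definition ups (G D : ctx) (rho : ty) (s : sub G D)
  : sub (rho :: G) (rho :: D) :=
  scons (Var V0) (fun tau v => rent shift (s tau v)).

Definition idsub (G : ctx) : sub G G := fun _ v => Var v.
Arguments idsub {G} tau _.

(* Terms have no binder: lambda-abstraction of the last variable is the usual
   bracket abstraction, with [Sigma Pi Pi] as the identity. *)
Definition lam_var (G : ctx) (rho tau : ty) (v : var (rho :: G) tau)
  : term G (rho ==> tau) :=
  match v in var G' tau' return
    match G' with
    | [] => unit
    | rho' :: G'' => term G'' (rho' ==> tau')
    end
  with
  | @V0 _ rho' =>
      Con (Sigma rho' (N ==> rho') rho') @ Con (Pi rho' (N ==> rho'))
        @ Con (Pi rho' N)
  | @VS _ tau' rho' w => Con (Pi tau' rho') @ Var w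
  end.

Fixpoint lam (G : ctx) (rho tau : ty) (t : term (rho :: G) tau)
  : term G (rho ==> tau) :=
  match t with
  | Var v => lam_var v
  | Con c => Con (Pi _ rho) @ Con c
  | App s u => Con (Sigma rho _ _) @ lam s @ lam u
  end.

Notation v0 := (Var V0).
Notation v1 := (Var (VS V0)).
Notation v2 := (Var (VS (VS V0))).

Definition zero (G : ctx) : term G N := Con Zero.
Arguments zero {G}.
Definition suc (G : ctx) (t : term G N) : term G N := Con Succ @ t.
Definition one (G : ctx) : term G N := suc zero.
Arguments one {G}.

(* In [R0 x y z] the step [z] takes the previous value first and then the
   index, as fixed by the axioms [ax_R0_zero] and [ax_R0_succ]. *)
Definition rec0 (G : ctx) (x y : term G N) (z : term G (N ==> N ==> N))
  : term G N := Con R0 @ x @ y @ z.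

Definition tpred (G : ctx) (t : term G N) : term G N :=
  rec0 t zero (lam (lam v0)).
Definition tadd (G : ctx) (s t : term G N) : term G N :=
  rec0 t s (lam (lam (suc v1))).
Definition tmonus (G : ctx) (s t : term G N) : term G N :=
  rec0 t s (lam (lam (tpred v1))).
Definition tmax (G : ctx) (s t : term G N) : term G N := tadd s (tmonus t s).
Definition tmin (G : ctx) (s t : term G N) : term G N := tmonus s (tmonus s t).

(** * Formulas *)

(* Equality at type 0 is the only primitive predicate. *)
Inductive form : ctx -> Type :=
| Eq : forall G : ctx, term G N -> term G N -> form G
| Bot : forall G : ctx, form G
| Imp : forall G : ctx, form G -> form G -> form G
| And : forall G : ctx, form G -> form G -> form G
| Or : forall G : ctx, form G -> form G -> form G
| All : forall (G : ctx) (rho : ty), form (rho :: G) -> form G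
| Ex : forall (G : ctx) (rho : ty), form (rho :: G) -> form G.
Arguments Bot {G}.
Arguments All {G} rho _.
Arguments Ex {G} rho _.
Bind Scope fm_scope with form.
Infix "=0" := Eq (at level 70, no associativity) : fm_scope.
Infix "~>" := Imp (at level 85, right associativity) : fm_scope.
Infix "\&" := And (at level 80, right associativity) : fm_scope.
Infix "\|" := Or (at level 83, right associativity) : fm_scope.
Open Scope fm_scope.

Definition Not (G : ctx) (A : form G) : form G := A ~> Bot.
Definition Iff (G : ctx) (A B : form G) : form G := (A ~> B) \& (B ~> A).

Fixpoint renf (G : ctx) (A : form G) {struct A}
  : forall D : ctx, ren G D -> form D :=
  match A in form G return forall D, ren G D -> form D with
  | Eq s t => fun D r => rent r s =0 rent r t
  | Bot => fun D r => Bot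
  | Imp A B => fun D r => renf A r ~> renf B r
  | And A B => fun D r => renf A r \& renf B r
  | Or A B => fun D r => renf A r \| renf B r
  | All rho A => fun D r => All rho (renf A (upr r))
  | Ex rho A => fun D r => Ex rho (renf A (upr r))
  end.

Fixpoint subf (G : ctx) (A : form G) {struct A}
  : forall D : ctx, sub G D -> form D :=
  match A in form G return forall D, sub G D -> form D with
  | Eq s t => fun D r => subt r s =0 subt r t
  | Bot => fun D r => Bot
  | Imp A B => fun D r => subf A r ~> subf B r
  | And A B => fun D r => subf A r \& subf B r
  | Or A B => fun D r => subf A r \| subf B r
  | All rho A => fun D r => All rho (subf A (ups r))
  | Ex rho A => fun D r => Ex rho (subf A (ups r))
  end.

Definition inst (G : ctx) (rho : ty) (A : form (rho :: G)) (t : term G rho)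
  : form G := subf A (scons t idsub).

Fixpoint qf (G : ctx) (A : form G) : Prop :=
  match A with
  | Eq _ _ | Bot => True
  | Imp A B | And A B | Or A B => qf A /\ qf B
  | All _ _ | Ex _ _ => False
  end.

Fixpoint eqt (tau : ty) : forall G : ctx, term G tau -> term G tau -> form G :=
  match tau with
  | N => fun G s t => s =0 t
  | rho ==> tau => fun G s t =>
      All rho (eqt (rent shift s @ v0) (rent shift t @ v0))
  end.

Definition sentence := form [].

Fixpoint closure (G : ctx) : form G -> sentence :=
  match G with
  | [] => fun A => A
  | rho :: G => fun A => closure (All rho A)
  end.

(** * Classical natural deduction *)

Definition theory := sentence -> Prop.

Definition extend (T : theory) (A : sentence) : theory :=
  fun B => T B \/ B = A.

Inductive derives (T : theory)
  : forall G : ctx, list (form G) -> form G -> Prop :=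
| d_ax G (H : list (form G)) (A : sentence) :
    T A -> derives T H (renf A (@from_nil G))
| d_hyp G (H : list (form G)) A : In A H -> derives T H A
| d_impI G (H : list (form G)) A B :
    derives T (A :: H) B -> derives T H (A ~> B)
| d_impE G (H : list (form G)) A B :
    derives T H (A ~> B) -> derives T H A -> derives T H B
| d_andI G (H : list (form G)) A B :
    derives T H A -> derives T H B -> derives T H (A \& B)
| d_andE1 G (H : list (form G)) A B : derives T H (A \& B) -> derives T H A
| d_andE2 G (H : list (form G)) A B : derives T H (A \& B) -> derives T H B
| d_orI1 G (H : list (form G)) A B : derives T H A -> derives T H (A \| B)
| d_orI2 G (H : list (form G)) A B : derives T H B -> derives T H (A \| B)
| d_orE G (H : list (form G)) A B C :
    derives T H (A \| B) -> derives T (A :: H) C -> derives T (B :: H) C ->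
    derives T H C
| d_botE G (H : list (form G)) A : derives T H Bot -> derives T H A
| d_dne G (H : list (form G)) A :
    derives T H (Not (Not A)) -> derives T H A
| d_allI G (H : list (form G)) rho (A : form (rho :: G)) :
    derives T (map (fun B => renf B shift) H) A -> derives T H (All rho A)
| d_allE G (H : list (form G)) rho (A : form (rho :: G)) (t : term G rho) :
    derives T H (All rho A) -> derives T H (inst A t)
| d_exI G (H : list (form G)) rho (A : form (rho :: G)) (t : term G rho) :
    derives T H (inst A t) -> derives T H (Ex rho A)
| d_exE G (H : list (form G)) rho (A : form (rho :: G)) C :
    derives T H (Ex rho A) ->
    derives T (A :: map (fun B => renf B shift) H) (renf C shift) ->
    derives T H C.

Definition proves (T : theory) (A : sentence) : Prop := derives T [] A.

(** * The systems *)

(* A(x+1), with x still the last variable. *)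
Definition step (G : ctx) (A : form (N :: G)) : form (N :: G) :=
  subf A (scons (suc v0) (fun _ v => Var (VS v))).

(* For A(f,x) with x = v0 and f = v1: the formula A(f,F(f)) in the context
   where f = v0 and F = v1. *)
Definition choice_inst (G : ctx) (A : form (N :: ty1 :: G))
  : form (ty1 :: ty2 :: G) :=
  subf A (scons (v1 @ v0) (scons v0 (fun _ v => Var (VS (VS v))))).

(* The parameters of the two schemata are the variables of [G]; congruence of
   [=0] for application is an instance of extensionality. *)
Inductive RCA0w : theory :=
| ax_refl : RCA0w (All N (v0 =0 v0))
| ax_sym : RCA0w (All N (All N (v1 =0 v0 ~> v0 =0 v1)))
| ax_trans :
    RCA0w (All N (All N (All N (v2 =0 v1 ~> v1 =0 v0 ~> v2 =0 v0))))
| ax_succ_nonzero : RCA0w (All N (Not (suc v0 =0 zero)))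
| ax_succ_inj : RCA0w (All N (All N (suc v1 =0 suc v0 ~> v1 =0 v0)))
| ax_Pi rho tau :
    RCA0w (All rho (All tau (eqt (Con (Pi rho tau) @ v1 @ v0) v1)))
| ax_Sigma rho sigma tau :
    RCA0w (All (rho ==> sigma ==> tau) (All (rho ==> sigma) (All rho
      (eqt (Con (Sigma rho sigma tau) @ v2 @ v1 @ v0)
           (v2 @ v0 @ (v1 @ v0))))))
| ax_R0_zero :
    RCA0w (All N (All (N ==> N ==> N) (rec0 zero v1 v0 =0 v1)))
| ax_R0_succ :
    RCA0w (All N (All N (All (N ==> N ==> N)
      (rec0 (suc v2) v1 v0 =0 v0 @ rec0 v2 v1 v0 @ v2))))
| ax_QF_induction G (A : form (N :: G)) :
    qf A ->
    RCA0w (closure (inst A zero \& All N (A ~> step A) ~> All N A))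
| ax_ext rho tau :
    RCA0w (All (rho ==> tau) (All rho (All rho
      (eqt v1 v0 ~> eqt (v2 @ v1) (v2 @ v0)))))
| ax_QF_AC10 G (A : form (N :: ty1 :: G)) :
    qf A ->
    RCA0w (closure (All ty1 (Ex N A) ~> Ex ty2 (All ty1 (choice_inst A)))).

Definition Pi01_CA : sentence :=
  All (N ==> N ==> N) (Ex ty1 (All N
    (Iff (v1 @ v0 =0 zero)
         (All N (Var (VS (VS (VS V0))) @ v1 @ v0 =0 zero))))).

Definition ACA0w : theory := extend RCA0w Pi01_CA.

Definition mu_axiom : sentence :=
  Ex ty2 (All ty1 (Ex N (v1 @ v0 =0 zero) ~> v0 @ (v1 @ v0) =0 zero)).

(** * Non-principal ultrafilters *)

(* A set is a type-1 object X with n in X iff X(n) = 0, so intersection is a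
   maximum and the complement is 1 - X(n); [ltf n k] is (n+1) - k = 0, with
   truncated subtraction. *)
Definition mem (G : ctx) (n : term G N) (X : term G ty1) : form G :=
  X @ n =0 zero.
Definition memU (G : ctx) (X : term G ty1) (U : term G ty2) : form G :=
  U @ X =0 zero.
Definition inter (G : ctx) (X Y : term G ty1) : term G ty1 :=
  lam (tmax (rent shift X @ v0) (rent shift Y @ v0)).
Definition compl (G : ctx) (X : term G ty1) : term G ty1 :=
  lam (tmonus one (rent shift X @ v0)).
Definition trunc1 (G : ctx) (X : term G ty1) : term G ty1 :=
  lam (tmin (rent shift X @ v0) one).
Definition ltf (G : ctx) (n k : term G N) : form G :=
  tmonus (suc n) k =0 zero.

Definition U_axiom : sentence :=
  Ex ty2 (
    All ty1 (memU v0 v1 \| memU (compl v0) v1)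
  \& All ty1 (All ty1 (memU (inter v1 v0) v2 ~> memU v0 v2))
  \& All ty1 (All ty1 (memU v1 v2 \& memU v0 v2 ~> memU (inter v1 v0) v2))
  \& All ty1 (memU v0 v1 ~> All N (Ex N (ltf v1 v0 \& mem v0 v2)))
  \& All ty1 (v1 @ v0 =0 v1 @ trunc1 v0)).

(* Main.v *)
(* The set X_f of all k such that f has a zero below k is cofinite if f has a
   zero and empty otherwise. A non-principal ultrafilter U contains no finite
   set and contains X_f or its complement, so "X_f is in U" is a
   quantifier-free formula equivalent to "f has a zero". Hence every f has an x
   with "if X_f is in U then f(x) = 0", and QF-AC^{1,0} turns x into a
   functional of f, which is mu. Given mu, Pi^0_1-comprehension for f is
   witnessed by g(n) = f(n, mu(h_n)) where h_n(x) = 0 iff f(n, x) is nonzero. *)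
From Stdlib Require Import List Setoid Morphisms.
Require Import Defs.
Import ListNotations.

Set Implicit Arguments.
Unset Strict Implicit.
Unset Printing Implicit Defensive.

(** * Substitution *)

(** The return type matches on the context index and takes the motive as an argument inside the
    branch, so dependent elimination needs no axiom on equality of contexts. *)
Definition var_case (G : ctx) (rho : ty)
  (P : forall tau, var (rho :: G) tau -> Prop)
  (P0 : P rho V0) (PS : forall tau (v : var G tau), P tau (VS v))
  (tau : ty) (v : var (rho :: G) tau) : P tau v :=
  match v in var G' tau' return
    match G' return var G' tau' -> Prop with
    | [] => fun _ => True
    | rho' :: G'' => fun v =>
        forall P : forall tau, var (rho' :: G'') tau -> Prop,
        P rho' V0 -> (forall tau (v : var G'' tau), P tau (VS v)) -> P tau' v
    end v
  with
  | V0 => fun P P0 _ => P0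
  | VS w => fun P _ PS => PS _ w
  end P P0 PS.

Definition var_nil (P : forall tau, var [] tau -> Prop) (tau : ty)
  (v : var [] tau) : P tau v :=
  match v in var G' tau' return
    match G' return var G' tau' -> Prop with
    | [] => fun v => forall P : forall tau, var [] tau -> Prop, P tau' v
    | _ :: _ => fun _ => True
    end v
  with V0 => I | VS _ => I end P.

Ltac var_split :=
  let tau := fresh "tau" in let v := fresh "v" in
  intros tau v; pattern tau, v;
  first [apply var_nil | apply var_case; clear tau v].

(** Viewing renamings as substitutions reduces every commutation law involving a renaming to the
    laws of substitution. *)
Definition ren_sub (G D : ctx) (r : ren G D) : sub G D :=
  fun tau v => Var (r tau v).

Definition nil_sub (G : ctx) : sub [] G := ren_sub (@from_nil G).
Arguments nil_sub {G} tau _.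

Definition comp (G D E : ctx) (s : sub G D) (s' : sub D E) : sub G E :=
  fun tau v => subt s' (s tau v).

(** Substitutions are Rocq functions and are compared pointwise, which makes function extensionality
    unnecessary. *)
Lemma subt_ext (G D : ctx) (s s' : sub G D) :
  (forall tau v, s tau v = s' tau v) ->
  forall tau (t : term G tau), subt s t = subt s' t.
Proof.
  intros E tau t; induction t; simpl; congruence.
Qed.

Lemma subt_id (G : ctx) (s : sub G G) :
  (forall tau v, s tau v = Var v) ->
  forall tau (t : term G tau), subt s t = t.
Proof.
  intros E tau t; induction t; simpl; congruence.
Qed.

Lemma rent_subt (G D : ctx) (r : ren G D) tau (t : term G tau) :
  rent r t = subt (ren_sub r) t.
Proof.
  induction t; simpl; try congruence; easy.
Qed.

Lemma subt_subt (G D E : ctx) (s : sub G D) (s' : sub D E) tau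
    (t : term G tau) : subt s' (subt s t) = subt (comp s s') t.
Proof.
  induction t; simpl; try congruence; easy.
Qed.

Lemma subt_shift (G D : ctx) rho (u : term D rho) (s : sub G D) tau
    (t : term G tau) : subt (scons u s) (rent shift t) = subt s t.
Proof.
  now rewrite rent_subt, subt_subt.
Qed.

Lemma subt_inst_shift (G : ctx) rho (u : term G rho) tau (t : term G tau) :
  subt (scons u idsub) (rent shift t) = t.
Proof.
  rewrite subt_shift; now apply subt_id.
Qed.

Lemma subt_ups_shift (G D : ctx) rho (s : sub G D) tau (t : term G tau) :
  subt (ups (rho := rho) s) (rent shift t) = rent shift (subt s t).
Proof.
  unfold ups; rewrite subt_shift, rent_subt, subt_subt.
  apply subt_ext; intros; apply rent_subt.
Qed.

Lemma ups_ext (G D : ctx) rho (s s' : sub G D) :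
  (forall tau v, s tau v = s' tau v) ->
  forall tau v, ups (rho := rho) s (tau := tau) v = ups s' v.
Proof.
  intros E; var_split; cbn; congruence.
Qed.

Lemma subf_ext (G : ctx) (A : form G) (D : ctx) (s s' : sub G D) :
  (forall tau v, s tau v = s' tau v) -> subf A s = subf A s'.
Proof.
  revert D s s'; induction A; intros D s s' E; simpl; f_equal;
    auto using subt_ext.
  - apply IHA; now apply ups_ext.
  - apply IHA; now apply ups_ext.
Qed.

Lemma ups_ren_sub (G D : ctx) rho (r : ren G D) tau (v : var (rho :: G) tau) :
  ups (ren_sub r) v = ren_sub (upr r) v.
Proof.
  revert tau v; now var_split.
Qed.

Lemma renf_subf (G : ctx) (A : form G) (D : ctx) (r : ren G D) :
  renf A r = subf A (ren_sub r).
Proof.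
  revert D r; induction A; intros D r; simpl; f_equal; auto using rent_subt.
  - rewrite IHA; apply subf_ext; intros; symmetry; apply ups_ren_sub.
  - rewrite IHA; apply subf_ext; intros; symmetry; apply ups_ren_sub.
Qed.

Lemma ups_comp (G D E : ctx) rho (s : sub G D) (s' : sub D E) tau
    (v : var (rho :: G) tau) :
  comp (ups s) (ups s') v = ups (comp s s') v.
Proof.
  revert tau v; var_split; cbn; [easy|].
  intros; apply subt_ups_shift.
Qed.

Lemma subf_subf (G : ctx) (A : form G) (D E : ctx) (s : sub G D)
    (s' : sub D E) : subf (subf A s) s' = subf A (comp s s').
Proof.
  revert D E s s'; induction A; intros D E s s'; simpl; f_equal;
    auto using subt_subt.
  - rewrite IHA; apply subf_ext; intros; apply ups_comp.
  - rewrite IHA; apply subf_ext; intros; apply ups_comp.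
Qed.

Lemma ups_id (G : ctx) rho (s : sub G G) :
  (forall tau v, s tau v = Var v) ->
  forall tau v, ups (rho := rho) s (tau := tau) v = Var v.
Proof.
  intros E; var_split; cbn; [easy|].
  intros ? ?; now rewrite E.
Qed.

Lemma subf_id (G : ctx) (A : form G) (s : sub G G) :
  (forall tau v, s tau v = Var v) -> subf A s = A.
Proof.
  revert s; induction A; intros s E; simpl; f_equal; auto using subt_id.
  - apply IHA; now apply ups_id.
  - apply IHA; now apply ups_id.
Qed.

Lemma subf_eqt tau (G D : ctx) (t u : term G tau) (s : sub G D) :
  subf (eqt t u) s = eqt (subt s t) (subt s u).
Proof.
  revert G D t u s; induction tau; intros G D t u s; simpl; [easy|].
  rewrite IHtau2; simpl; now rewrite !subt_ups_shift.
Qed.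

Lemma renf_eqt tau (G D : ctx) (t u : term G tau) (r : ren G D) :
  renf (eqt t u) r = eqt (rent r t) (rent r u).
Proof.
  now rewrite renf_subf, subf_eqt, !rent_subt.
Qed.

Lemma renf_sentence (A : sentence) (r : ren [] []) : renf A r = A.
Proof.
  rewrite renf_subf; apply subf_id; var_split.
Qed.

(** * Equational reasoning inside the theory *)

(** Makes a closed axiom available in any context through one simultaneous substitution. By
    induction on [G], the tail of [s] instantiates the outer quantifiers and its value at [V0] the
    innermost one. *)
Lemma d_closure (T : theory) (G : ctx) (B : form G) :
  T (closure B) ->
  forall (D : ctx) (H : list (form D)) (s : sub G D), derives T H (subf B s).
Proof.
  intros hB D H.
  pose proof (@d_ax T D H _ hB) as h; clear hB; revert B h.
  induction G as [|rho G IH]; intros B h s; simpl in h.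
  - replace (subf B s) with (renf B (@from_nil D)); [exact h|].
    rewrite renf_subf; apply subf_ext; var_split.
  - specialize (IH _ h (fun tau v => s tau (VS v))); simpl in IH.
    apply d_allE with (t := s rho V0) in IH; unfold inst in IH.
    rewrite subf_subf in IH.
    erewrite subf_ext; [exact IH|].
    var_split; [easy|].
    intros; unfold comp; simpl; symmetry; apply subt_inst_shift.
Qed.

Lemma d_weaken (T : theory) (G : ctx) (H H' : list (form G)) (A : form G) :
  derives T H A -> incl H H' -> derives T H' A.
Proof.
  intros h; revert H'.
  induction h; intros H' i; try (econstructor; eauto; fail).
  - apply d_impI, IHh; auto using incl_cons, in_eq, incl_tl.
  - eapply d_orE; [now apply IHh1|apply IHh2|apply IHh3];
      auto using incl_cons, in_eq, incl_tl.
  - apply d_allI, IHh; now apply incl_map.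
  - eapply d_exE; [now apply IHh1|apply IHh2].
    apply incl_cons; [apply in_eq|]; now apply incl_tl, incl_map.
Qed.

Lemma d_cons (T : theory) (G : ctx) (H : list (form G)) (A B : form G) :
  derives T H A -> derives T (B :: H) A.
Proof.
  intro h; apply (d_weaken h), incl_tl, incl_refl.
Qed.

Ltac set_hyps L :=
  match goal with |- ?g =>
    let g' := eval hnf in g in
    match g' with derives _ ?L' _ => set (L := L') end
  end.

Ltac hyp := apply d_hyp; repeat (first [left; reflexivity | right]).

Section Theory.
Variable T : theory.
Hypothesis T_RCA : forall A, RCA0w A -> T A.

(** Provable equality as a Rocq relation, so that setoid rewriting performs equational reasoning
    inside the object theory. *)
Definition eqd (G : ctx) (H : list (form G)) (tau : ty) (t u : term G tau)
  : Prop := derives T H (eqt t u).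
Arguments eqd {G} H {tau} t u.

Lemma d_axiom (G : ctx) (B : form G) (D : ctx) (H : list (form D))
    (s : sub G D) : RCA0w (closure B) -> derives T H (subf B s).
Proof.
  auto using d_closure.
Qed.

Lemma d_allE2 (G : ctx) (H : list (form G)) rho sigma
    (A : form (sigma :: rho :: G)) (a : term G rho) (b : term G sigma) :
  derives T H (All rho (All sigma A)) ->
  derives T H (subf A (scons b (scons a idsub))).
Proof.
  intro h; apply d_allE with (t := a) in h; simpl in h.
  apply d_allE with (t := b) in h; unfold inst in h.
  rewrite subf_subf in h; erewrite subf_ext; [exact h|].
  var_split; [easy|].
  intros; symmetry; apply (subt_inst_shift b).
Qed.

Lemma d_allE3 (G : ctx) (H : list (form G)) rho sigma tau
    (A : form (tau :: sigma :: rho :: G)) (a : term G rho) (b : term G sigma)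
    (c : term G tau) :
  derives T H (All rho (All sigma (All tau A))) ->
  derives T H (subf A (scons c (scons b (scons a idsub)))).
Proof.
  intro h; apply d_allE2 with (a := a) (b := b) in h; simpl in h.
  apply d_allE with (t := c) in h; unfold inst in h.
  rewrite subf_subf in h; erewrite subf_ext; [exact h|].
  var_split; [easy|].
  intros; symmetry; apply (subt_inst_shift c).
Qed.

Lemma d_nnE (G : ctx) (H : list (form G)) (A : form G) :
  derives T (Not A :: H) Bot -> derives T H A.
Proof.
  intro h; now apply d_dne, d_impI.
Qed.

Lemma d_em (G : ctx) (H : list (form G)) (A C : form G) :
  derives T (A :: H) C -> derives T (Not A :: H) C -> derives T H C.
Proof.
  intros h h'; apply d_nnE.
  assert (n : derives T (Not C :: H) (Not A)).
  { apply d_impI, (d_impE (A := C)); [hyp|].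
    apply (d_weaken h); intros B [->|i]; simpl; auto. }
  refine (d_impE (A := C) _ (d_impE (A := Not A) _ n)); [hyp|].
  now apply d_cons, d_impI.
Qed.

Lemma not_ex (G : ctx) (H : list (form G)) rho (A : form (rho :: G)) :
  derives T H (Not (Ex rho A)) -> derives T H (All rho (Not A)).
Proof.
  intro h.
  (* Moving the negation among the hypotheses lets [d_allI] shift it under the new quantifier. The
     same device recurs below. *)
  refine (d_impE (A := Not (Ex rho A)) _ h).
  apply d_impI, d_allI, d_impI.
  eapply d_impE; [apply d_hyp; right; now left|].
  apply d_exI with (t := v0); unfold inst.
  rewrite renf_subf, subf_subf, subf_id; [hyp|].
  now var_split.
Qed.

(** Equality at an arrow type is a universally quantified equation, so congruence in the function
    position is mere instantiation. *)
Lemma eqd_app1 (G : ctx) (H : list (form G)) rho tau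
    (t u : term G (rho ==> tau)) (a : term G rho) :
  eqd H t u -> eqd H (t @ a) (u @ a).
Proof.
  intro h; apply d_allE with (t := a) in h; unfold inst in h.
  rewrite subf_eqt in h; simpl in h; now rewrite !subt_inst_shift in h.
Qed.

Lemma eqd_lift (G : ctx) (H : list (form G)) tau (t u : term G tau) :
  In (eqt t u) H ->
  forall rho, In (eqt (rent shift t) (rent shift u))
    (map (fun B => renf B (@shift G rho)) H).
Proof.
  intros i rho; rewrite <- renf_eqt;
  now apply in_map with (f := fun B => renf B _).
Qed.

Lemma eqd_refl (G : ctx) (H : list (form G)) tau (t : term G tau) : eqd H t t.
Proof.
  revert G H t; induction tau; intros G H t.
  - exact (d_axiom (B := v0 =0 v0) H (scons t nil_sub)
             ax_refl).
  - apply d_allI, IHtau2.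
Qed.

Lemma eqt_sym tau (G : ctx) (H : list (form G)) (t u : term G tau) :
  derives T H (eqt t u ~> eqt u t).
Proof.
  revert G H t u; induction tau; intros G H t u.
  - exact (d_axiom (B := v1 =0 v0 ~> v0 =0 v1) H
      (scons u (scons t nil_sub)) ax_sym).
  - apply d_impI, d_allI.
    eapply d_impE; [apply IHtau2|].
    apply eqd_app1, d_hyp.
    apply eqd_lift with (tau := Arr _ _); now left.
Qed.

Lemma eqt_trans tau (G : ctx) (H : list (form G)) (t u w : term G tau) :
  derives T H (eqt t u ~> eqt u w ~> eqt t w).
Proof.
  revert G H t u w; induction tau; intros G H t u w.
  - exact (d_axiom (B := v2 =0 v1 ~> v1 =0 v0 ~> v2 =0 v0) H
      (scons w (scons u (scons t nil_sub))) ax_trans).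
  - apply d_impI, d_impI, d_allI.
    eapply d_impE; [eapply d_impE; [apply IHtau2|]|];
      apply eqd_app1, d_hyp; apply eqd_lift with (tau := Arr _ _);
      [right|]; now left.
Qed.

#[local] Instance eqd_equiv (G : ctx) (H : list (form G)) tau :
  Equivalence (@eqd G H tau).
Proof.
  split.
  - intro t; apply eqd_refl.
  - intros t u h; exact (d_impE (eqt_sym H t u) h).
  - intros t u w h k; exact (d_impE (d_impE (eqt_trans H t u w) h) k).
Qed.

#[local] Instance app_eqd (G : ctx) (H : list (form G)) rho tau :
  Proper (eqd H ==> eqd H ==> eqd H) (@App G rho tau).
Proof.
  intros t u h a b k.
  transitivity (u @ a); [now apply eqd_app1|].
  (* Congruence in the argument position is where the extensionality axiom enters. *)
  refine (d_impE _ k).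
  pose proof (@d_axiom [rho; rho; rho ==> tau]
    (eqt v1 v0 ~> eqt (v2 @ v1) (v2 @ v0)) G H
    (scons b (scons a (scons u nil_sub)))
    (ax_ext rho tau)) as e.
  simpl in e; now rewrite !subf_eqt in e.
Qed.

Lemma eqd_Pi (G : ctx) (H : list (form G)) rho tau (a : term G rho)
    (b : term G tau) : eqd H (Con (Pi rho tau) @ a @ b) a.
Proof.
  pose proof (@d_axiom [tau; rho] (eqt (Con (Pi rho tau) @ v1 @ v0) v1) G H
    (scons b (scons a nil_sub))
    (ax_Pi rho tau)) as e.
  now rewrite subf_eqt in e.
Qed.

Lemma eqd_Sigma (G : ctx) (H : list (form G)) rho sigma tau
    (a : term G (rho ==> sigma ==> tau)) (b : term G (rho ==> sigma))
    (c : term G rho) :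
  eqd H (Con (Sigma rho sigma tau) @ a @ b @ c) (a @ c @ (b @ c)).
Proof.
  pose proof (@d_axiom [rho; rho ==> sigma; rho ==> sigma ==> tau]
    (eqt (Con (Sigma rho sigma tau) @ v2 @ v1 @ v0) (v2 @ v0 @ (v1 @ v0))) G H
    (scons c (scons b (scons a nil_sub)))
    (ax_Sigma rho sigma tau)) as e.
  now rewrite subf_eqt in e.
Qed.

(* Stated under a substitution because [subt] commutes with [lam] only up to
   provable equality: bracket abstraction looks inside the substituted terms. *)
Lemma eqd_beta (G D : ctx) (H : list (form D)) (s : sub G D) rho tau
    (t : term (rho :: G) tau) (a : term D rho) :
  eqd H (subt s (lam t) @ a) (subt (scons a s) t).
Proof.
  induction t as [tau v|tau c|sigma tau t IHt u IHu]; simpl.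
  - revert tau v; var_split; simpl.
    + rewrite eqd_Sigma; apply eqd_Pi.
    + intros; apply eqd_Pi.
  - apply eqd_Pi.
  - now rewrite eqd_Sigma, IHt, IHu.
Qed.

Lemma eqd_beta2 (G D : ctx) (H : list (form D)) (s : sub G D) rho sigma tau
    (t : term (sigma :: rho :: G) tau) (a : term D rho) (b : term D sigma) :
  eqd H (subt s (lam (lam t)) @ a @ b) (subt (scons b (scons a s)) t).
Proof.
  now rewrite !eqd_beta.
Qed.

Lemma eqd_R0_zero (G : ctx) (H : list (form G)) (a : term G N)
    (b : term G (N ==> N ==> N)) : eqd H (rec0 zero a b) a.
Proof.
  exact (d_axiom (B := rec0 zero v1 v0 =0 v1) H
    (scons b (scons a nil_sub)) ax_R0_zero).
Qed.

Lemma eqd_R0_succ (G : ctx) (H : list (form G)) (n a : term G N)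
    (b : term G (N ==> N ==> N)) :
  eqd H (rec0 (suc n) a b) (b @ rec0 n a b @ n).
Proof.
  exact (d_axiom (B := rec0 (suc v2) v1 v0 =0 v0 @ rec0 v2 v1 v0 @ v2) H
    (scons b (scons a (scons n nil_sub))) ax_R0_succ).
Qed.

#[local] Instance rec0_eqd (G : ctx) (H : list (form G)) :
  Proper (eqd H ==> eqd H ==> eqd H ==> eqd H) (@rec0 G).
Proof.
  unfold rec0; intros ? ? e1 ? ? e2 ? ? e3; now rewrite e1, e2, e3.
Qed.

#[local] Instance suc_eqd (G : ctx) (H : list (form G)) :
  Proper (eqd H ==> eqd H) (@suc G).
Proof.
  unfold suc; intros ? ? e; now rewrite e.
Qed.

#[local] Instance tpred_eqd (G : ctx) (H : list (form G)) :
  Proper (eqd H ==> eqd H) (@tpred G).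
Proof.
  unfold tpred; intros ? ? e; now rewrite e.
Qed.

#[local] Instance tadd_eqd (G : ctx) (H : list (form G)) :
  Proper (eqd H ==> eqd H ==> eqd H) (@tadd G).
Proof.
  unfold tadd; intros ? ? e ? ? e'; now rewrite e, e'.
Qed.

#[local] Instance tmonus_eqd (G : ctx) (H : list (form G)) :
  Proper (eqd H ==> eqd H ==> eqd H) (@tmonus G).
Proof.
  unfold tmonus; intros ? ? e ? ? e'; now rewrite e, e'.
Qed.

(** * Arithmetic *)

Lemma tadd_0 (G : ctx) (H : list (form G)) (a : term G N) :
  eqd H (tadd a zero) a.
Proof.
  apply eqd_R0_zero.
Qed.

Lemma tadd_suc (G : ctx) (H : list (form G)) (a b : term G N) :
  eqd H (tadd a (suc b)) (suc (tadd a b)).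
Proof.
  unfold tadd; rewrite eqd_R0_succ.
  exact (@eqd_beta2 G G H idsub _ _ _ (suc v1) _ _).
Qed.

Lemma tpred_0 (G : ctx) (H : list (form G)) : eqd H (tpred (@zero G)) zero.
Proof.
  apply eqd_R0_zero.
Qed.

Lemma tpred_suc (G : ctx) (H : list (form G)) (a : term G N) :
  eqd H (tpred (suc a)) a.
Proof.
  unfold tpred; rewrite eqd_R0_succ.
  exact (@eqd_beta2 G G H idsub _ _ _ v0 _ _).
Qed.

Lemma tmonus_0 (G : ctx) (H : list (form G)) (a : term G N) :
  eqd H (tmonus a zero) a.
Proof.
  apply eqd_R0_zero.
Qed.

Lemma tmonus_suc (G : ctx) (H : list (form G)) (a b : term G N) :
  eqd H (tmonus a (suc b)) (tpred (tmonus a b)).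
Proof.
  unfold tmonus; rewrite eqd_R0_succ.
  exact (@eqd_beta2 G G H idsub _ _ _ (tpred v1) _ _).
Qed.

Lemma suc_nonzero (G : ctx) (H : list (form G)) (a : term G N) (A : form G) :
  eqd H (suc a) zero -> derives T H A.
Proof.
  intro h; apply d_botE.
  exact (d_impE (d_axiom (B := Not (suc v0 =0 zero)) H
    (scons a nil_sub) ax_succ_nonzero) h).
Qed.

Lemma suc_inj (G : ctx) (H : list (form G)) (a b : term G N) :
  eqd H (suc a) (suc b) -> eqd H a b.
Proof.
  intro h.
  exact (d_impE (d_axiom (B := suc v1 =0 suc v0 ~> v1 =0 v0) H
    (scons b (scons a nil_sub)) ax_succ_inj) h).
Qed.

Lemma subf_idsub (G : ctx) (A : form G) : subf A idsub = A.
Proof.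
  now apply subf_id.
Qed.

Lemma qf_induction (G : ctx) (H : list (form G)) (A : form (N :: G)) :
  qf A -> derives T H (inst A zero) ->
  derives T (A :: map (fun B => renf B shift) H) (step A) ->
  derives T H (All N A).
Proof.
  intros q h0 hS.
  (* The identity substitution makes the variables of the current context the parameters of the
     schema. *)
  pose proof (d_axiom H idsub (ax_QF_induction q)) as h.
  rewrite subf_idsub in h.
  apply (d_impE h), d_andI; [exact h0|].
  now apply d_allI, d_impI.
Qed.

(** Naming the predecessor by [tpred] keeps the disjunction quantifier-free, so it can be proved by
    the available induction. *)
Lemma nat_case (G : ctx) (H : list (form G)) (a : term G N) (C : form G) :
  derives T ((a =0 zero) :: H) C -> derives T ((a =0 suc (tpred a)) :: H) C ->
  derives T H C.
Proof.
  apply d_orE.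
  refine (d_allE (A := v0 =0 zero \| v0 =0 suc (tpred v0)) a _).
  apply qf_induction; [now simpl| |].
  - apply d_orI1; exact (eqd_refl H zero).
  - apply d_orI2.
    set_hyps H'; change (eqd H' (suc v0) (suc (tpred (suc v0)))).
    now rewrite tpred_suc.
Qed.

Lemma tadd_0_l (G : ctx) (H : list (form G)) (a : term G N) :
  eqd H (tadd zero a) a.
Proof.
  refine (d_allE (A := tadd zero v0 =0 v0) a _).
  apply qf_induction; [easy|exact (tadd_0 H zero)|].
  set_hyps H'; change (eqd H' (tadd zero (suc v0)) (suc v0)).
  rewrite tadd_suc; apply suc_eqd; hyp.
Qed.

Lemma tadd_suc_l (G : ctx) (H : list (form G)) (a b : term G N) :
  eqd H (tadd (suc a) b) (suc (tadd a b)).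
Proof.
  refine (d_allE2 (A := tadd (suc v1) v0 =0 suc (tadd v1 v0)) a b _).
  apply d_allI, qf_induction; [easy| |].
  - set_hyps H'; change (eqd H' (tadd (suc v0) zero) (suc (tadd v0 zero))).
    now rewrite !tadd_0.
  - set_hyps H'.
    change (eqd H' (tadd (suc v1) (suc v0)) (suc (tadd v1 (suc v0)))).
    rewrite !tadd_suc; apply suc_eqd; hyp.
Qed.

(** Either a < b in the sense of [ltf], or b can be added back to the difference. By induction on b:
    a zero difference stays zero, and a positive one passes one unit from the difference to b. *)
Lemma tmonus_cases (G : ctx) (H : list (form G)) (a b : term G N) :
  derives T H (tmonus (suc a) b =0 zero
               \| suc a =0 tadd (tmonus (suc a) b) b).
Proof.
  refine (d_allE2 (A := tmonus (suc v1) v0 =0 zero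
                     \| suc v1 =0 tadd (tmonus (suc v1) v0) v0) a b _).
  apply d_allI, qf_induction; [now simpl| |].
  - apply d_orI2.
    set_hyps H'; change (eqd H' (suc v0) (tadd (tmonus (suc v0) zero) zero)).
    now rewrite tadd_0, tmonus_0.
  - set_hyps H'; change (derives T H' (tmonus (suc v1) (suc v0) =0 zero
                \| suc v1 =0 tadd (tmonus (suc v1) (suc v0)) (suc v0))).
    apply nat_case with (a := tmonus (suc v1) v0).
    + apply d_orI1; set_hyps K.
      assert (e : eqd K (tmonus (suc v1) v0) zero) by hyp.
      change (eqd K (tmonus (suc v1) (suc v0)) zero).
      rewrite tmonus_suc, e; apply tpred_0.
    + eapply d_orE; [apply d_hyp; right; now left| |].
      * apply d_orI1; set_hyps K.
        assert (e : eqd K (tmonus (suc v1) v0) zero) by hyp.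
        change (eqd K (tmonus (suc v1) (suc v0)) zero).
        rewrite tmonus_suc, e; apply tpred_0.
      * apply d_orI2; set_hyps K.
        assert (e : eqd K (suc v1) (tadd (tmonus (suc v1) v0) v0)) by hyp.
        assert (e' : eqd K (tmonus (suc v1) v0)
                           (suc (tpred (tmonus (suc v1) v0)))) by hyp.
        change (eqd K (suc v1) (tadd (tmonus (suc v1) (suc v0)) (suc v0))).
        rewrite e at 1; rewrite e' at 1.
        now rewrite tmonus_suc, tadd_suc_l, tadd_suc.
Qed.

(** * Bounded search *)

(** The recursor on the previous value serves as a case distinction: zero is kept, a nonzero value
    is replaced by that of the function at the index. The function is an argument of a closed
    combinator, so substituting into [search f] yields a search by computation. *)
Definition search_step (G : ctx) : term G (ty1 ==> N ==> N ==> N) :=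
  lam (lam (lam (rec0 v1 zero
    (lam (lam (Var (VS (VS (VS (VS V0)))) @ v2)))))).

(* [search f @ k] vanishes iff [f] has a zero below [k]. *)
Definition search (G : ctx) (f : term G ty1) : term G ty1 :=
  lam (lam (rec0 v0 one v1)) @ (search_step G @ f).

Lemma search_rec (G : ctx) (H : list (form G)) (f : term G ty1) (k : term G N) :
  eqd H (search f @ k) (rec0 k one (search_step G @ f)).
Proof.
  exact (@eqd_beta2 G G H idsub _ _ _ (rec0 v0 one v1) _ _).
Qed.

Lemma search_0 (G : ctx) (H : list (form G)) (f : term G ty1) :
  eqd H (search f @ zero) one.
Proof.
  rewrite search_rec; apply eqd_R0_zero.
Qed.

(** The branch function stays under its substitution, because [subt] and [lam] do not commute by
    conversion; it is evaluated only once applied. *)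
Lemma search_suc (G : ctx) (H : list (form G)) (f : term G ty1)
    (k : term G N) :
  eqd H (search f @ suc k)
    (rec0 (search f @ k) zero
       (subt (scons k (scons (rec0 k one (search_step G @ f)) (scons f idsub)))
          (lam (lam (Var (VS (VS (VS (VS V0)))) @ v2))))).
Proof.
  rewrite !search_rec, eqd_R0_succ.
  etransitivity; [apply eqd_app1|].
  - exact (@eqd_beta2 G G H idsub _ _ _ (lam (rec0 v1 zero
      (lam (lam (Var (VS (VS (VS (VS V0)))) @ v2))))) f _).
  - apply eqd_beta.
Qed.

Lemma search_suc_found (G : ctx) (H : list (form G)) (f : term G ty1)
    (k : term G N) :
  eqd H (search f @ k) zero -> eqd H (search f @ suc k) zero.
Proof.
  intro e; rewrite search_suc, e; apply eqd_R0_zero.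
Qed.

Lemma search_suc_next (G : ctx) (H : list (form G)) (f : term G ty1)
    (k p : term G N) :
  eqd H (search f @ k) (suc p) -> eqd H (search f @ suc k) (f @ k).
Proof.
  intro e; rewrite search_suc, e, eqd_R0_succ.
  apply eqd_beta2.
Qed.

Lemma search_complete (G : ctx) (H : list (form G)) (f : term G ty1)
    (a b : term G N) :
  eqd H (f @ a) zero -> eqd H (tmonus (suc a) b) zero ->
  eqd H (search f @ b) zero.
Proof.
  intros h h'.
  refine (d_impE (d_impE _ h) h').
  refine (d_allE3 (A := v2 @ v1 =0 zero ~> tmonus (suc v1) v0 =0 zero ~>
                        search v2 @ v0 =0 zero) f a b _).
  clear h h'; apply d_allI, d_allI, qf_induction; [now simpl| |].
  - apply d_impI, d_impI.
    apply suc_nonzero with (a := v0).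
    set_hyps K; change (eqd K (suc v0) zero).
    rewrite <- (tmonus_0 K (suc v0)); hyp.
  - apply d_impI, d_impI; set_hyps K.
    assert (e : eqd K (v2 @ v1) zero) by hyp.
    assert (e1 : eqd K (tmonus (suc v1) (suc v0)) zero) by hyp.
    assert (IH : derives T K (v2 @ v1 =0 zero ~> tmonus (suc v1) v0 =0 zero ~>
                              search v2 @ v0 =0 zero)) by hyp.
    change (eqd K (search v2 @ suc v0) zero).
    rewrite tmonus_suc in e1; clearbody K.
    apply nat_case with (a := tmonus (suc v1) v0).
    + apply search_suc_found.
      refine (d_impE (d_impE (d_cons _ IH) (d_cons _ e)) _); hyp.
    (* The difference of [suc v1] and [v0] is positive with predecessor zero, hence one. By
       [tmonus_cases], [v1] equals [v0], so [v2] vanishes at [v0] and the search succeeds at the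
       next bound at the latest. *)
    + set_hyps L.
      assert (e2 : eqd L (tmonus (suc v1) v0) one).
      { etransitivity; [apply d_hyp; now left|].
        now apply suc_eqd, d_cons. }
      assert (e3 : eqd L (v2 @ v1) zero) by now apply d_cons.
      clearbody L.
      eapply d_orE; [exact (tmonus_cases L v1 v0)| |].
      * apply suc_nonzero with (a := zero).
        rewrite <- (d_cons _ e2 : eqd _ _ _); hyp.
      * set_hyps M.
        assert (e4 : eqd M v1 v0).
        { apply suc_inj; rewrite <- (tadd_0_l M v0), <- tadd_suc_l.
          etransitivity; [apply d_hyp; now left|].
          apply tadd_eqd; [now apply d_cons|easy]. }
        assert (e5 : eqd M (v2 @ v1) zero) by now apply d_cons.
        rewrite e4 in e5; clearbody M.
        apply nat_case with (a := search v2 @ v0).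
        -- apply search_suc_found; hyp.
        -- set_hyps M'; change (eqd M' (search v2 @ suc v0) zero).
           etransitivity; [eapply search_suc_next; hyp|apply d_cons, e5].
Qed.

(** In this contrapositive form the universal statement is only a side hypothesis, and the formula
    proved by induction is quantifier-free. *)
Lemma search_sound (G : ctx) (H : list (form G)) :
  derives T H (All ty1 (All N (Not (v1 @ v0 =0 zero)) ~>
                        All N (Not (search v1 @ v0 =0 zero)))).
Proof.
  apply d_allI, d_impI, qf_induction; [now simpl| |].
  - apply d_impI, suc_nonzero with (a := zero).
    set_hyps K; change (eqd K one zero).
    rewrite <- (search_0 K v0); hyp.
  - apply d_impI; set_hyps K.
    assert (h : derives T K (All N (Not (v2 @ v0 =0 zero)))) by hyp.
    assert (e : eqd K (search v1 @ suc v0) zero) by hyp.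
    assert (IH : derives T K (Not (search v1 @ v0 =0 zero))) by hyp.
    clearbody K.
    apply nat_case with (a := search v1 @ v0).
    + apply (d_impE (d_cons _ IH)); hyp.
    + set_hyps L.
      assert (e' : eqd L (search v1 @ suc v0) zero) by now apply d_cons.
      assert (e1 : eqd L (search v1 @ suc v0) (v1 @ v0))
        by (eapply search_suc_next; hyp).
      rewrite e1 in e'; refine (d_impE _ e').
      exact (d_allE v0 (d_cons _ h)).
Qed.

(** * Ultrafilters, choice and comprehension *)

Lemma qf_choice (G : ctx) (H : list (form G)) (A : form (N :: ty1 :: G)) :
  qf A -> derives T H (All ty1 (Ex N A)) ->
  derives T H (Ex ty2 (All ty1 (choice_inst A))).
Proof.
  intros q h.
  pose proof (d_axiom H idsub (ax_QF_AC10 q)) as e.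
  rewrite subf_idsub in e; exact (d_impE e h).
Qed.

(** Instantiating the ultrafilter axiom at X produces [compl v0] under a substitution, which for
    compound X does not convert to [compl X]. *)
Lemma compl_spec (G D : ctx) (H : list (form D)) (s : sub G D)
    (X : term D ty1) (k : term D N) :
  eqd H (subt (scons X s) (compl v0) @ k) (tmonus one (X @ k)).
Proof.
  exact (eqd_beta H (scons X s) (tmonus one (v1 @ v0)) k).
Qed.

Lemma compl_disjoint (G D : ctx) (H : list (form D)) (s : sub G D)
    (X : term D ty1) (k : term D N) (A : form D) :
  eqd H (X @ k) zero -> eqd H (subt (scons X s) (compl v0) @ k) zero ->
  derives T H A.
Proof.
  intros h h'; rewrite compl_spec, h, tmonus_0 in h'.
  exact (suc_nonzero A h').
Qed.

Lemma ultrafilter_search (G : ctx) (H : list (form G)) :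
  derives T H (All ty2 (
    All ty1 (memU v0 v1 \| memU (compl v0) v1) ~>
    All ty1 (memU v0 v1 ~> All N (Ex N (ltf v1 v0 \& mem v0 v2))) ~>
    All ty1 (Iff (memU (search v0) v1) (Ex N (v1 @ v0 =0 zero))))).
Proof.
  apply d_allI, d_impI, d_impI, d_allI, d_andI.
  - apply d_impI, d_nnE; set_hyps K.
    assert (h4 : derives T K
      (All ty1 (memU v0 v2 ~> All N (Ex N (ltf v1 v0 \& mem v0 v2))))) by hyp.
    assert (n : derives T K (All N (Not (v1 @ v0 =0 zero))))
      by (apply not_ex; hyp).
    assert (s : derives T K (All N (Not (search v1 @ v0 =0 zero))))
      by exact (d_impE (d_allE v0 (search_sound K)) n).
    (* Non-principality with bound zero shows that a set in the ultrafilter has an element. *)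
    assert (e : derives T K (Ex N (ltf zero v0 \& mem v0 (search v1)))).
    { refine (d_allE zero (d_impE (d_allE (search v0) h4) _)); hyp. }
    refine (d_impE (d_impI _) s).
    refine (d_exE (d_cons _ e) _).
    eapply d_impE; [|eapply d_andE2; hyp].
    refine (d_allE (A := Not (search (Var (VS (VS V0))) @ v0 =0 zero)) v0 _);
      hyp.
  - apply d_impI; eapply d_exE; [hyp|].
    eapply d_orE; [|hyp|].
    + set_hyps K.
      assert (h1 : derives T K
        (All ty1 (memU v0 (Var (VS (VS (VS V0)))) \|
                  memU (compl v0) (Var (VS (VS (VS V0))))))) by hyp.
      exact (d_allE (search v1) h1).
    + set_hyps K.
      assert (h4 : derives T K
        (All ty1 (memU v0 (Var (VS (VS (VS V0)))) ~>
           All N (Ex N (ltf v1 v0 \& mem v0 v2))))) by hyp.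
      apply (d_allE (subt (scons (search v1) idsub) (compl v0))) in h4.
      eapply d_exE.
      (* The bound is the given zero of f. An element of the complement beyond it lies in the search
         set as well, by [search_complete]. *)
      * refine (d_allE v0 (d_impE h4 _)); hyp.
      * set_hyps L.
        eapply (compl_disjoint (X := search v2) (s := idsub) (k := v0)).
        -- apply search_complete with (a := v1); [hyp|].
           change (derives T L (tmonus (suc v1) v0 =0 zero)).
           eapply d_andE1; hyp.
        -- eapply d_andE2; hyp.
Qed.

(** The recursor on the value of the function gives one at its zeros and zero elsewhere. Being a
    closed combinator, it is stable under substitution by computation. *)
Definition negation (G : ctx) : term G (ty1 ==> ty1) :=
  lam (lam (rec0 (v1 @ v0) one (lam (lam zero)))).

Lemma negation_rec (G : ctx) (H : list (form G)) (f : term G ty1)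
    (k : term G N) :
  eqd H (negation G @ f @ k) (rec0 (f @ k) one (lam (lam zero))).
Proof.
  exact (@eqd_beta2 G G H idsub _ _ _
    (rec0 (v1 @ v0) one (lam (lam zero))) _ _).
Qed.

Lemma negation_0 (G : ctx) (H : list (form G)) (f : term G ty1)
    (k : term G N) (A : form G) :
  eqd H (f @ k) zero -> eqd H (negation G @ f @ k) zero -> derives T H A.
Proof.
  intros e e'; apply suc_nonzero with (a := zero).
  transitivity (negation G @ f @ k); [|exact e'].
  rewrite negation_rec, e; symmetry; apply eqd_R0_zero.
Qed.

Lemma negation_suc (G : ctx) (H : list (form G)) (f : term G ty1)
    (k p : term G N) :
  eqd H (f @ k) (suc p) -> eqd H (negation G @ f @ k) zero.
Proof.
  intro e; rewrite negation_rec, e, eqd_R0_succ.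
  exact (@eqd_beta2 G G H idsub _ _ _ zero _ _).
Qed.

Lemma mu_Pi01_CA (H : list sentence) :
  derives T H mu_axiom -> derives T H Pi01_CA.
Proof.
  intro h; refine (d_exE h _); clear h; apply d_allI.
  apply d_exI with (t := lam (v1 @ v0 @ (v2 @ (negation _ @ (v1 @ v0))))).
  apply d_allI; set_hyps K.
  pose (y := v2 @ (negation _ @ (v1 @ v0))
             : term [N; N ==> N ==> N; ty2] N).
  (* The comprehension witness as it appears under the quantifier over n, written as a substitution
     instance so that [eqd_beta] applies. *)
  pose (g := subt (fun _ v => Var (VS v))
               (lam (v1 @ v0 @ (v2 @ (negation _ @ (v1 @ v0)))))
             : term [N; N ==> N ==> N; ty2] ty1).
  assert (e : eqd K (g @ v0) (v1 @ v0 @ y))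
    by exact (eqd_beta K _ (v1 @ v0 @ (v2 @ (negation _ @ (v1 @ v0)))) v0).
  change (derives T K (Iff (g @ v0 =0 zero) (All N (v2 @ v1 @ v0 =0 zero)))).
  apply d_andI.
  - apply d_impI.
    apply (d_impE (A := v1 @ v0 @ y =0 zero)).
    2:{ set_hyps L; change (eqd L (v1 @ v0 @ y) zero).
        rewrite <- (d_cons _ e : eqd L _ _); hyp. }
    apply d_impI, d_allI.
    (* A nonzero value of f(n, x) makes x a zero of the negation, so mu returns a zero of the
       negation too. This contradicts that f(n, y) is zero at the value y of mu. *)
    apply nat_case with (a := v2 @ v1 @ v0); [hyp|].
    set_hyps L.
    assert (m : derives T L (All ty1 (Ex N (v1 @ v0 =0 zero) ~>
      v0 @ (Var (VS (VS (VS (VS V0)))) @ v0) =0 zero))) by hyp.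
    apply (d_allE (negation _ @ (v2 @ v1))) in m.
    eapply (negation_0 (f := v2 @ v1)
              (k := Var (VS (VS (VS V0))) @ (negation _ @ (v2 @ v1)))).
    + hyp.
    + refine (d_impE m _).
      apply d_exI with (t := v0).
      eapply (negation_suc (f := v2 @ v1) (k := v0)); hyp.
  - apply d_impI; set_hyps L.
    change (eqd L (g @ v0) zero).
    rewrite (d_cons _ e : eqd L _ _).
    refine (d_allE (A := v2 @ v1 @ v0 =0 zero) y _); hyp.
Qed.

End Theory.

Lemma ultrafilter_mu : proves (extend RCA0w U_axiom) mu_axiom.
Proof.
  assert (hR : forall A, RCA0w A -> extend RCA0w U_axiom A) by now left.
  assert (u : derives (extend RCA0w U_axiom) [] U_axiom).
  (* [d_ax] delivers an axiom renamed out of the empty context, and this renaming fixes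
     sentences. *)
  { rewrite <- (renf_sentence U_axiom (@from_nil _)); apply d_ax; now right. }
  refine (d_exE u _); clear u; set_hyps K.
  assert (E : derives (extend RCA0w U_axiom) K (
    All ty1 (Iff (memU (search v0) v1) (Ex N (v1 @ v0 =0 zero))))).
  { refine (d_impE (d_impE (d_allE v0 (ultrafilter_search hR K)) _) _).
    - eapply d_andE1; hyp.
    - eapply d_andE1, d_andE2, d_andE2, d_andE2; hyp. }
  refine (d_impE (d_impI _) E); clear E.
  (* The ultrafilter [v2] enters the choice formula as a type 2 parameter. *)
  refine (d_exE (qf_choice hR (A := memU (search v1) v2 ~> v1 @ v0 =0 zero)
                   _ _) _); [now simpl| |].
  - apply d_allI; set_hyps L.
    assert (E : derives (extend RCA0w U_axiom) L
      (All ty1 (Iff (memU (search v0) v2) (Ex N (v1 @ v0 =0 zero))))) by hyp.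
    apply d_em with (A := memU (search v0) v1).
    + refine (d_exE (d_impE (d_andE1 (d_allE v0 (d_cons _ E))) _) _); [hyp|].
      apply d_exI with (t := v0), d_impI; hyp.
    (* Outside the ultrafilter the implication is vacuous, and zero is a default value. *)
    + apply d_exI with (t := zero), d_impI, d_botE.
      eapply d_impE; [apply d_cons; hyp|hyp].
  (* The choice functional itself is mu: if f has a zero, then E puts its search set in the
     ultrafilter, and C gives the zero. *)
  - apply d_exI with (t := v0), d_allI, d_impI; set_hyps L.
    assert (E : derives (extend RCA0w U_axiom) L
      (All ty1 (Iff (memU (search v0) (Var (VS (VS (VS V0)))))
                    (Ex N (v1 @ v0 =0 zero))))) by hyp.
    assert (C : derives (extend RCA0w U_axiom) L
      (All ty1 (memU (search v0) (Var (VS (VS (VS V0)))) ~>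
                v0 @ (v2 @ v0) =0 zero))) by hyp.
    refine (d_impE (d_allE v0 C) (d_impE (d_andE2 (d_allE v0 E)) _)); hyp.
Qed.

Theorem theorem3 :
  proves (extend RCA0w U_axiom) mu_axiom /\
  (forall A : sentence, ACA0w A -> proves (extend RCA0w U_axiom) A).
Proof.
  split; [exact ultrafilter_mu|].
  intros A [h | ->].
  - rewrite <- (renf_sentence A (@from_nil _)); apply d_ax; now left.
  - apply mu_Pi01_CA; [now left|exact ultrafilter_mu].
Qed.
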